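(* Let $q_\theta$ be the probability density on $\mathbb{R}^d$ of the output of a normalizing flow and let $p(y|x)$ ($y\in\mathbb{R}^m$, $x\in\mathbb{R}^d$) be a likelihood. Suppose that $\sup_{x\in\mathbb{R}^d} q_\theta(x)<+\infty$ and that, for any $y\in\mathbb{R}^m$, $\sup_{x\in\mathbb{R}^d}p(y|x)<+\infty$ and $p(y|\cdot)\in \mathrm{C}^1(\mathbb{R}^d,(0,+\infty))$. Let $\lambda>0$. Then, for any convex and compact set $C\subset\mathbb{R}^d$, any $\alpha>0$ and any $y\in\mathbb{R}^m$, $$\int_{\mathbb{R}^d} p(y|x)\, q_\theta^\alpha(x)\exp\left(-\frac{\|x-\Pi_C(x)\|_2^2}{2\lambda}\right)\mathrm{d}x<+\infty.$$ Hence the posterior density $p_\lambda(x|y)$ is well-defined.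
   Context: $\Pi_C$ is the Euclidean projection onto the (nonempty) convex compact set $C$, $q_\theta^\alpha(x) = (q_\theta(x))^\alpha$, and $\iota_C^{(\lambda)}(x)=\frac{1}{2\lambda}\|x-\Pi_C(x)\|_2^2$ is the $\lambda$-Moreau envelope of the indicator function of $C$. The posterior density is $$p_\lambda(x|y)=\frac{p(y|x)\,q_\theta^\alpha(x)\exp(-\iota_C^{(\lambda)}(x))}{\int_{\mathbb{R}^d}p(y|\tilde x)\,q_\theta^\alpha(\tilde x)\exp(-\iota_C^{(\lambda)}(\tilde x))\,\mathrm{d}\tilde x}.$$ The output density of a normalizing flow $x=T(z)$, $z\sim q_z$, with $T:\mathbb{R}^d\to\mathbb{R}^d$ invertible and $T,T^{-1}$ differentiable, is $q_\theta(x)=q_z(T^{-1}(x))|\det J_{T^{-1}}(x)|$, where $J_{T^{-1}}$ is the Jacobian matrix of $T^{-1}$. *)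

(* Defs.v *)
From HB Require Import structures.
From mathcomp Require Import all_boot all_order all_algebra.
From mathcomp Require Import all_classical all_reals all_analysis.

Set Implicit Arguments.
Unset Strict Implicit.
Unset Printing Implicit Defensive.

Import Order.TTheory GRing.Theory Num.Theory.
Import numFieldNormedType.Exports.

Local Open Scope classical_set_scope.
Local Open Scope ring_scope.

(* R^n is 'rV[R]_n.  Its measurable sets are the product sigma-algebra of the
   Borel sets of R, as the library does for n.-tuple; this is the Borel
   sigma-algebra of R^n. *)
Definition measure_rV_display : measure_display.
Proof. exact: default_measure_display. Qed.

Section measurable_rV.
Context {R : realType} (n : nat).

Let coors : 'I_n -> 'rV[R]_n -> R := fun i x => x 0 i.

Let rV_set0 : g_sigma_preimage coors set0.
Proof. exact: sigma_algebra0. Qed.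

Let rV_setC A : g_sigma_preimage coors A -> g_sigma_preimage coors (~` A).
Proof. exact: sigma_algebraC. Qed.

Let rV_bigcup (F : _^nat) : (forall i, g_sigma_preimage coors (F i)) ->
  g_sigma_preimage coors (\bigcup_i (F i)).
Proof. exact: sigma_algebra_bigcup. Qed.

HB.instance Definition _ := @isMeasurable.Build measure_rV_display
  'rV[R]_n (g_sigma_preimage coors) rV_set0 rV_setC rV_bigcup.

End measurable_rV.

Lemma measurable_coord (R : realType) n (i : 'I_n) :
  measurable_fun [set: 'rV[R]_n] (fun x : 'rV[R]_n => x 0 i).
Proof.
move=> _ Y mY; rewrite setTI; apply: sub_sigma_algebra => /=.
rewrite -bigcup_seq/=; exists i => /=; first by rewrite mem_index_enum.
by exists Y => //; rewrite setTI.
Qed.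

Lemma measurable_fun_rVP d (T : measurableType d) (R : realType) n
    (f : T -> 'rV[R]_n) :
  measurable_fun [set: T] f <->
  forall i, measurable_fun [set: T] (fun t => f t 0 i).
Proof.
split=> [mf i|mf].
  by apply: (measurableT_comp (measurable_coord i)).
move=> _ A mA; rewrite setTI; move: A mA.
have sA : sigma_algebra [set: 'rV[R]_n] [set A | measurable (f @^-1` A)].
  split; rewrite /= ?preimage_set0//.
  - by move=> A /= mA; rewrite setTD preimage_setC; exact: measurableC.
  - by move=> F mF; rewrite /= preimage_bigcup; exact: bigcup_measurable.
apply: smallest_sub; first exact: sA.
rewrite -bigcup_seq => A /= [i _ [Y mY <-]].
rewrite setTI -comp_preimage -[X in measurable X]setTI.
exact: mf.
Qed.

Section lebesgue_rV.
Context {R : realType}.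

Definition rV_cons n (xv : R * 'rV[R]_n) : 'rV[R]_n.+1 :=
  \row_i oapp (xv.2 0) xv.1 (unlift ord0 i).

Lemma rV_cons0 n xv : @rV_cons n xv 0 ord0 = xv.1.
Proof. by rewrite mxE unlift_none. Qed.

Lemma rV_consS n xv i : @rV_cons n xv 0 (lift ord0 i) = xv.2 0 i.
Proof. by rewrite mxE liftK. Qed.

Lemma measurable_rV_cons n : measurable_fun [set: _] (@rV_cons n).
Proof.
apply/measurable_fun_rVP => i; case: (unliftP ord0 i) => [j ->|->].
  under eq_fun do rewrite rV_consS.
  by apply: (measurableT_comp (measurable_coord j)).
by under eq_fun do rewrite rV_cons0; exact: measurable_fst.
Qed.

Section step.
Variables (n : nat) (mu : {sigma_finite_measure set 'rV[R]_n -> \bar R}).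
Local Open Scope ereal_scope.

Definition lebesgue_rV_step : set 'rV[R]_n.+1 -> \bar R :=
  pushforward (lebesgue_measure \x mu) (@rV_cons n).

Let nu : {measure set _ -> \bar R} :=
  measure_function_pushforward__canonical__measure_function_Measure
    (lebesgue_measure \x mu) (@measurable_rV_cons n).

Let step0 : lebesgue_rV_step set0 = 0.
Proof. exact: (measure0 nu). Qed.

Let step_ge0 A : 0 <= lebesgue_rV_step A.
Proof. exact: (measure_ge0 nu). Qed.

Let step_sigma_additive : semi_sigma_additive lebesgue_rV_step.
Proof. exact: (@measure_semi_sigma_additive _ _ _ nu). Qed.

HB.instance Definition _ := isMeasure.Build _ _ _
  lebesgue_rV_step step0 step_ge0 step_sigma_additive.

Let step_sigma_finite : sigma_finite setT lebesgue_rV_step.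
Proof.
have /sigma_finiteP[F [TF ndF mF]] := sigma_finiteT (@lebesgue_measure R).
have /sigma_finiteP[G [TG ndG mG]] := sigma_finiteT mu.
pose hd_tl (v : 'rV[R]_n.+1) := (v 0%R ord0, \row_i v 0%R (lift ord0 i)).
have mh : measurable_fun setT hd_tl.
  apply/measurable_fun_pairP; split => /=; first exact: measurable_coord.
  by apply/measurable_fun_rVP => i; under eq_fun do rewrite mxE;
    exact: measurable_coord.
have hK : cancel (@rV_cons n) hd_tl.
  move=> [x v]; rewrite /hd_tl rV_cons0; congr pair.
  by apply/rowP => i; rewrite mxE rV_consS.
exists (fun k => hd_tl @^-1` (F k `*` G k)).
  rewrite -preimage_bigcup (_ : \bigcup_k _ = setT) ?preimage_setT//.
  rewrite -subTset => -[x v] _; move: (I : setT x) (I : setT v).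
  rewrite [in X in X -> _]TF [in X in _ -> X -> _]TG => -[i _ Fx] [j _ Gv].
  exists (maxn i j) => //; split => /=.
  - by move: x Fx; exact/subsetPset/ndF/leq_maxl.
  - by move: v Gv; exact/subsetPset/ndG/leq_maxr.
move=> k; have [mFk Fk] := mF k; have [mGk Gk] := mG k; split.
  by rewrite -[X in measurable X]setTI; apply: mh => //; exact: measurableX.
rewrite /lebesgue_rV_step /pushforward -comp_preimage.
rewrite (_ : _ \o _ = id) ?preimage_id; last by apply/funext => xv /=; rewrite hK.
by rewrite product_measure1E// lte_mul_pinfty// ge0_fin_numE.
Qed.

HB.instance Definition _ := Measure_isSigmaFinite.Build _ _ _
  lebesgue_rV_step step_sigma_finite.

End step.

(* Lebesgue measure on R^n as an iterated product measure. *)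
Fixpoint lebesgue_rV n : {sigma_finite_measure set 'rV[R]_n -> \bar R} :=
  match n with
  | 0 => \d_(0%R : 'rV[R]_0)
  | m.+1 => lebesgue_rV_step (lebesgue_rV m)
  end.

Lemma lebesgue_rV_box n (a b : 'rV[R]_n) : (forall i, a 0 i <= b 0 i) ->
  lebesgue_rV n [set x : 'rV[R]_n | forall i, a 0 i <= x 0 i <= b 0 i] =
  (\prod_(i < n) (b 0 i - a 0 i))%:E.
Proof.
elim: n a b => [|n IHn] a b ab.
  rewrite big_ord0 /= diracE mem_set// => -[].
  by case.
pose tl (v : 'rV[R]_n.+1) : 'rV[R]_n := \row_i v 0 (lift ord0 i).
rewrite big_ord_recl EFinM /= /lebesgue_rV_step /pushforward.
rewrite (_ : _ @^-1` _ = `[a 0 ord0, b 0 ord0] `*`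
  [set x : 'rV[R]_n | forall i, tl a 0 i <= x 0 i <= tl b 0 i]); last first.
  apply/seteqP; split => [[x v] /= h|[x v] /= [hx hv] i].
    split; first by have := h ord0; rewrite rV_cons0 in_itv.
    by move=> i; have := h (lift ord0 i); rewrite rV_consS !mxE.
  case: (unliftP ord0 i) => [j ->|->].
    by have := hv j; rewrite rV_consS !mxE.
  by rewrite rV_cons0; move: hx; rewrite in_itv.
rewrite product_measure1E//; last first.
  rewrite (_ : [set _ | _] =
    \bigcap_(i in [set: 'I_n]) ((fun x : 'rV[R]_n => x 0 i) @^-1`
       `[tl a 0 i, tl b 0 i])); last first.
    apply/seteqP; split=> [x /= h i _|x h i] /=; first by rewrite in_itv; exact: h.
    by have := h i I; rewrite /= in_itv.
  apply: fin_bigcap_measurable => // i _.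
  rewrite -[X in measurable X]setTI; apply: measurable_coord => //.
rewrite IHn; last by move=> i; rewrite !mxE.
congr (_ * _)%E.
  apply: etrans (lebesgue_measure_itv `[a 0 ord0, b 0 ord0]) _; rewrite /= lte_fin.
  have := ab ord0; rewrite le_eqVlt => /orP[/eqP->|->]; last by rewrite EFinB.
  by rewrite ltxx subrr.
by congr EFin; apply: eq_bigr => i _; rewrite !mxE.
Qed.

End lebesgue_rV.

(* The norm `|x| of the library on 'rV[R]_d is the sup norm. *)
Definition euclid_norm (R : realType) d (x : 'rV[R]_d) : R :=
  Num.sqrt (\sum_(i < d) x 0 i ^+ 2).

(* Euclidean projection onto C: the closest point of C, which exists and is
   unique for C nonempty, convex and compact. *)
Definition euclid_proj (R : realType) d (C : set 'rV[R]_d) (x : 'rV[R]_d) : 'rV[R]_d :=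
  get [set u | C u /\ forall v, C v -> euclid_norm (x - u) <= euclid_norm (x - v)].

Definition moreau_indicator (R : realType) d (C : set 'rV[R]_d) (lambda : R)
    (x : 'rV[R]_d) : R :=
  (2 * lambda)^-1 * euclid_norm (x - euclid_proj C x) ^+ 2.

Definition is_density (R : realType) d (q : 'rV[R]_d -> R) : Prop :=
  [/\ measurable_fun setT q, forall x, 0 <= q x &
      (\int[lebesgue_rV d]_x (q x)%:E = 1)%E].

(* Density of the output x = T z, z ~ qz, of a normalizing flow with inverse
   Tinv.  The library's 'J is the transpose of the usual Jacobian matrix (it
   acts on row vectors), which has the same determinant. *)
Definition flow_density (R : realType) d (qz : 'rV[R]_d -> R)
    (Tinv : 'rV[R]_d -> 'rV[R]_d) (x : 'rV[R]_d) : R :=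
  qz (Tinv x) * `|\det ('J Tinv x)|.

Definition C1 (R : realType) d (f : 'rV[R]_d -> R) : Prop :=
  (forall x, differentiable f x) /\
  (forall i : 'I_d, continuous (fun x => 'D_(delta_mx 0 i) f x)).

Section posterior.
Variables (R : realType) (m d : nat).
(* p y x is the likelihood p(y|x), q the prior density q_theta *)
Variables (p : 'rV[R]_m -> 'rV[R]_d -> R) (q : 'rV[R]_d -> R).
Variables (C : set 'rV[R]_d) (lambda alpha : R) (y : 'rV[R]_m).

Definition posterior_unnormalized (x : 'rV[R]_d) : R :=
  p y x * q x `^ alpha * expR (- moreau_indicator C lambda x).

Definition posterior_normalization : \bar R :=
  (\int[lebesgue_rV d]_x (posterior_unnormalized x)%:E)%E.

Definition posterior (x : 'rV[R]_d) : R :=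
  posterior_unnormalized x / fine posterior_normalization.

End posterior.

(* Main.v *)
Require Import Defs.
From HB Require Import structures.
From mathcomp Require Import all_boot all_order all_algebra.
From mathcomp Require Import all_classical all_reals all_analysis.
From mathcomp Require Import measurable_realfun ring lra.
Import Order.TTheory GRing.Theory Num.Theory.
Import numFieldNormedType.Exports.
Local Open Scope classical_set_scope.
Local Open Scope ring_scope.

Set Implicit Arguments.
Unset Strict Implicit.
Unset Printing Implicit Defensive.

(** Finiteness.  The likelihood and the power of the flow density are bounded by
    constants.  A point of the compact set [C] has bounded coordinates, so the
    squared distance from [x] to [C] grows at least like [`|x|^2 / 2] up to a
    constant, and the exponential factor is below a multiple of a product of
    normal densities of the coordinates ([expR_moreau_le]).  That product
    integrates to 1 by Tonelli's theorem ([integral_prod_coord]).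

    Positivity.  The integrand vanishes exactly where the flow density does, so
    the normalization constant could only be 0 if the flow density were 0
    almost everywhere.  A proof through the change of variables formula would
    show that the flow density has integral 1; less suffices.  Since [T] and
    [Tinv] are differentiable and inverse to each other, the chain rule gives
    that the Jacobian determinant of [Tinv] has no zero ([det_jacobian_neq0]).
    Hence [Tinv] maps the support of the flow density onto the support of [qz].
    An everywhere differentiable map of [R^d] to itself maps negligible sets to
    negligible sets ([differentiable_negligible]), so a negligible support of
    the flow density would make the support of [qz] negligible, although [qz]
    has integral 1.

    The statement on negligible sets rests on the dyadic cubes.  Call a set
    dyadically open when each of its points lies in a dyadic cube contained in
    the set.  Such a set is a countable disjoint union of cubes, as small as
    desired ([dopen_trivIset]), and a finite measure is outer regular with
    respect to these sets ([dopen_regular]).  So a negligible set is covered by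
    small disjoint cubes of small total volume; on the pieces of the set where
    the difference quotients are bounded by a given constant, the map expands
    every cube by a bounded factor ([lipschitz_negligible]).

    Measurability.  Ordinary open sets are dyadically open, hence measurable,
    and continuous functions are measurable.  The partial derivatives are
    pointwise limits of continuous difference quotients
    ([measurable_jacobian]), and the strict sublevel sets of the distance to
    [C] are open ([measurable_dist]). *)

(** * Dyadic cubes and outer regularity *)

Section dyadic.
Context {R : realType} {d : nat}.
Implicit Types (x y : 'rV[R]_d) (k : nat) (m : 'rV[int]_d) (U V : set 'rV[R]_d).

Definition didx k x : 'rV[int]_d := \row_i Num.floor (2 ^+ k * x 0 i).

Definition dcube k m : set 'rV[R]_d := [set x | didx k x = m].

(** The open sets of the topology that the dyadic cubes generate.  It is finer
    than the usual one and has a clopen base, hence both a half space and its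
    complement can be open. *)
Definition dopen U := forall x, U x -> exists k, dcube k (didx k x) `<=` U.

Lemma dcubeP k m x : dcube k m x <->
  forall i, (m 0 i)%:~R <= 2 ^+ k * x 0 i < (m 0 i + 1)%:~R.
Proof.
split=> [<- i|h]; first by rewrite mxE floor_le floorD1_gt.
apply/rowP => i; rewrite mxE; have /andP[h1 h2] := h i.
apply/eqP; rewrite eq_le floor_ge_int h1 andbT.
by rewrite -ltzD1 floor_lt_int h2.
Qed.

(** Dyadic cubes are nested: the halves of an integer interval [2n, 2n + 2[
    rescale into [n, n + 1[. *)
Lemma didxS k x y : didx k.+1 x = didx k.+1 y -> didx k x = didx k y.
Proof.
move=> h; apply/esym; rewrite -[RHS]/(didx k x) -/(dcube k (didx k x) y).
apply/dcubeP => i; move/rowP/(_ i): h; rewrite !mxE.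
set n := Num.floor (2 ^+ k * x 0 i).
have h1 : n%:~R <= 2 ^+ k * x 0 i := floor_le _.
have h2 : 2 ^+ k * x 0 i < (n + 1)%:~R := floorD1_gt _.
rewrite !exprS -!mulrA => h.
have g1 : 2 * n <= Num.floor (2 * (2 ^+ k * x 0 i)).
  by rewrite floor_ge_int intrM ler_pM2l.
have g2 : Num.floor (2 * (2 ^+ k * x 0 i)) < 2 * (n + 1).
  by rewrite floor_lt_int intrM ltr_pM2l.
move: g1 g2; rewrite h floor_ge_int floor_lt_int !intrM.
by rewrite ler_pM2l// ltr_pM2l// => -> ->.
Qed.

Lemma didx_le k l x y : (k <= l)%N -> didx l x = didx l y -> didx k x = didx k y.
Proof.
elim: l => [|l IH]; first by rewrite leqn0 => /eqP->.
by rewrite leq_eqVlt => /predU1P[->//|kl] /didxS; exact: IH.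
Qed.

Lemma didx_dist k x y : didx k x = didx k y -> `|x - y| <= 2 ^- k.
Proof.
move=> /rowP h; rewrite [`|_|]mx_normrE; apply/bigmax_leP; split=> [|[a i] _ /=].
  by rewrite invr_ge0 exprn_ge0.
rewrite ord1 !mxE; have := h i; rewrite !mxE => {}h.
have hx1 := floor_le (2 ^+ k * x 0 i); have hx2 := floorD1_gt (2 ^+ k * x 0 i).
have hy1 := floor_le (2 ^+ k * y 0 i); have hy2 := floorD1_gt (2 ^+ k * y 0 i).
have e0 : 0 < (2 ^+ k : R) by rewrite exprn_gt0.
rewrite -(ler_pM2l e0) divff ?gt_eqF// -[X in X * `|_|]gtr0_norm// -normrM.
move: hx1 hx2 hy1 hy2; rewrite h mulrBr !intrD; move: (_ * x _ _) (_ * y _ _).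
by move=> a' b ? ? ? ?; rewrite ler_norml; apply/andP; split; lra.
Qed.

Lemma measurable_dcube k m : measurable (dcube k m).
Proof.
rewrite (_ : dcube k m = \bigcap_(i in [set: 'I_d])
   ((fun x : 'rV[R]_d => 2 ^+ k * x 0 i) @^-1` `[(m 0 i)%:~R, (m 0 i + 1)%:~R[)).
  apply: fin_bigcap_measurable => // i _.
  rewrite -[X in measurable X]setTI.
  have : measurable_fun setT (fun x : 'rV[R]_d => 2 ^+ k * x 0 i).
    by apply: measurable_funM => //; exact: measurable_coord.
  by apply.
apply/seteqP; split=> x.
  by move=> /dcubeP h i _ /=; rewrite in_itv /= h.
by move=> h; apply/dcubeP => i; have := h i I; rewrite /= in_itv.
Qed.

Lemma dcube_dopen k m : dopen (dcube k m).
Proof. by move=> x <-; exists k. Qed.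

Lemma dopenI U V : dopen U -> dopen V -> dopen (U `&` V).
Proof.
move=> oU oV x [/oU[k hk] /oV[l hl]]; exists (maxn k l) => y /= h; split.
- by apply: hk; apply: didx_le h; exact: leq_maxl.
- by apply: hl; apply: didx_le h; exact: leq_maxr.
Qed.

Lemma dopen_bigcup I (D : set I) (F : I -> set 'rV[R]_d) :
  (forall i, D i -> dopen (F i)) -> dopen (\bigcup_(i in D) F i).
Proof.
by move=> oF x [i Di /(oF i Di)[k hk]]; exists k => y /hk Fy; exists i.
Qed.

Lemma dopen_bigcap_ord (F : nat -> set 'rV[R]_d) n :
  (forall i, dopen (F i)) -> dopen (\bigcap_(i < n) F i).
Proof.
move=> oF; elim: n => [|n IH]; first by rewrite II0 bigcap_set0 => x _; exists 0%N.
by rewrite bigcap_mkord big_ord_recr/= -bigcap_mkord; exact: dopenI.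
Qed.

(** The maximal cubes among those of level at least [k0] that lie in [U] are
    disjoint, by nestedness, and cover [U].  The lower bound [k0] on the levels
    allows to impose a maximal size on the cubes. *)
Lemma dopen_trivIset U k0 : dopen U ->
  exists J : nat -> option (nat * 'rV[int]_d),
  let Q n := oapp (fun km => dcube km.1 km.2) set0 (J n) in
  [/\ forall n km, J n = Some km -> (k0 <= km.1)%N,
      trivIset setT Q & U = \bigcup_n Q n].
Proof.
move=> oU.
pose sel (km : nat * 'rV[int]_d) := [/\ (k0 <= km.1)%N, dcube km.1 km.2 `<=` U &
  forall l x, (k0 <= l < km.1)%N -> dcube km.1 km.2 x -> ~ dcube l (didx l x) `<=` U].
pose J n := obind (fun km => if `[< sel km >] then Some km else None)
  (@pickle_inv (nat * 'rV[int]_d)%type n).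
have JP n km : J n = Some km -> pickle_inv n = Some km /\ sel km.
  by rewrite /J; case: pickle_inv => //= km'; case: asboolP => // ? [<-].
(* the inverse [pickle_inv] is injective where it is defined, so that every
   selected cube occurs only once in the sequence *)
exists J => Q; split.
- by move=> n km /JP[_ []].
- move=> n n' _ _ [x []]; rewrite /Q.
  case En : (J n) => [[l m]|//] /=; case En' : (J n') => [[l' m']|//] /= h h'.
  have [Pn [a b c]] := JP _ _ En; have [Pn' [a' b' c']] := JP _ _ En'.
  simpl in *.
  have ll' : l = l'.
    apply/eqP; rewrite eqn_leq; apply/andP; split; rewrite leqNgt; apply/negP => hl.
      by apply: (c l' x _ h); [rewrite a' hl|rewrite h'].
    by apply: (c' l x _ h'); [rewrite a hl|rewrite h].
  have mm' : m = m' by rewrite -h -h' ll'.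
  have := pickle_invK (n : nat) (T := (nat * 'rV[int]_d)%type).
  have := pickle_invK (n' : nat) (T := (nat * 'rV[int]_d)%type).
  by rewrite Pn Pn' /= ll' mm' => -> ->.
- apply/seteqP; split=> x; last first.
    move=> [n _]; rewrite /Q; case En : (J n) => [[l m]|//] /=.
    by have [_ [_ /= + _]] := JP _ _ En; exact.
  move=> Ux.
  have ex : exists l, (k0 <= l)%N && `[< dcube l (didx l x) `<=` U >].
    have [k hk] := oU _ Ux; exists (maxn k0 k); rewrite leq_maxl /=; apply/asboolP.
    by move=> y /(didx_le (leq_maxr k0 k)) h; exact: hk.
  case: (ex_minnP ex) => l /andP[kl /asboolP lU] lmin.
  exists (pickle (l, didx l x)) => //.
  rewrite /Q /J pickleK_inv/= asboolT//=; split => //= l' y /andP[kl' l'l] yx l'U.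
  have : (l <= l')%N.
    apply: lmin; rewrite kl'; apply/asboolP.
    by rewrite -(didx_le (ltnW l'l) yx).
  by rewrite leqNgt l'l.
Qed.

(** There are only countably many dyadic cubes. *)
Lemma dopen_measurable U : dopen U -> measurable U.
Proof.
move=> /(dopen_trivIset 0)[J [_ _ ->]]; apply: bigcupT_measurable => n.
by case: (J n) => [km|] //=; exact: measurable_dcube.
Qed.

Lemma exp2_gt (e : R) : 0 < e -> exists k, 2 ^- k < e.
Proof.
move=> e0; exists (Num.trunc e^-1).+1.
rewrite -[e in _ < e]invrK ltf_pV2 ?posrE ?invr_gt0 ?exprn_gt0//.
apply: (lt_trans (truncnS_gt _)).
by rewrite -natrX ltr_nat ltn_expl.
Qed.

Lemma open_dopen U : open U -> dopen U.
Proof.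
move=> oU x Ux; have /nbhs_ballP[e /= e0 he] := open_nbhs_nbhs (conj oU Ux).
have [k hk] := exp2_gt e0; exists k => y xy; apply: he.
rewrite -ball_normE /=; apply: le_lt_trans hk.
by apply: didx_dist; rewrite xy.
Qed.

Lemma continuous_measurable_fun_rV (f : 'rV[R]_d -> R) :
  continuous f -> measurable_fun setT f.
Proof.
move=> /continuousP cf.
apply: (measurability _ (RGenOInfty.measurableE R)) => _ [_ [x ->] <-].
rewrite setTI; apply: dopen_measurable; apply: open_dopen; apply: cf.
exact: interval_open.
Qed.

(** Outer regularity of a measure that is finite on [D], proved for a set and
    its complement at the same time: the covers [U] and [V] of the two then
    play symmetric roles, and the sets that admit such covers form a
    sigma-algebra. *)
Section regularity.
Variables (mu : {measure set 'rV[R]_d -> \bar R}) (D : set 'rV[R]_d).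
Hypotheses (mD : measurable D) (muD : (mu D < +oo)%E).

Let reg (A : set 'rV[R]_d) := forall e : R, 0 < e -> exists U V,
  [/\ dopen U, dopen V, A `<=` U, ~` A `<=` V & (mu (U `&` V `&` D) <= e%:E)%E].

Let reg_clopen A : dopen A -> dopen (~` A) -> reg A.
Proof.
move=> oA oCA e e0; exists A, (~` A); split => //.
by rewrite setICr set0I measure0 lee_fin ltW.
Qed.

Let regC A : reg A -> reg (~` A).
Proof.
move=> rA e /rA[U [V [oU oV AU AV h]]]; exists V, U; split => //.
  by rewrite setCK.
by rewrite (setIC V).
Qed.

Let reg_bigcup (A : (set 'rV[R]_d)^nat) : (forall n, reg (A n)) ->
  reg (\bigcup_n A n).
Proof.
move=> rA e e0.
have /choice[U /choice[V UV]] n : exists U V, [/\ dopen U, dopen V,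
    A n `<=` U, ~` A n `<=` V &
    (mu (U `&` V `&` D) <= ((e / 2) / (2 ^ n.+1)%:R)%:E)%E].
  by apply: rA; rewrite !divr_gt0// ltr0n expn_gt0.
(* The intersection of all the [V n] need not be open: a finite intersection
   is used instead, at a small cost since [mu] is finite on [D]. *)
pose W := \bigcup_n U n.
have oW : dopen W by apply: dopen_bigcup => n _; have [] := UV n.
pose F n := (W `&` D) `&` \bigcap_(i < n) V i.
have oV n : dopen (\bigcap_(i < n) V i).
  by apply: dopen_bigcap_ord => i; have [] := UV i.
have mF n : measurable (F n).
  by apply: measurableI; [apply: measurableI => //|]; exact: dopen_measurable.
have FE : \bigcap_n F n = (W `&` D) `&` \bigcap_n V n.
  apply/seteqP; split=> x.
    move=> h; split; first by have [] := h 0%N I.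
    by move=> n _; have [_] := h n.+1 I; apply; rewrite /= ltnSn.
  by move=> [WDx h] n _; split => // i _; exact: h.
have mFI : measurable (\bigcap_n F n) by exact: bigcapT_measurable.
have leFI : (mu (\bigcap_n F n) <= (e / 2)%:E)%E.
  have mUV n : measurable (U n `&` V n `&` D).
    apply: measurableI => //; apply: dopen_measurable.
    by have [? ? _ _ _] := UV n; exact: dopenI.
  apply: (@le_trans _ _ (\sum_(0 <= n <oo) mu (U n `&` V n `&` D))%E).
    apply: measure_sigma_subadditive => // x.
    by rewrite FE => -[[[n _ Ux] Dx] Vx]; exists n => //; split=> //; split => //; exact: Vx.
  apply: le_trans (epsilon_trick0 xpredT _); last by rewrite divr_ge0// ltW.
  by apply: lee_nneseries => // n _; have [] := UV n.
have cvgF : (mu \o F) x @[x --> \oo] --> mu (\bigcap_n F n).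
  apply: nonincreasing_cvg_mu => //.
    apply: le_lt_trans muD; apply: le_measure; rewrite ?inE//.
    by move=> x [[]].
  by move=> n k nk; apply/subsetPset => x [WDx h]; split => // i /= ?; apply: h => /=;
    exact: leq_trans nk.
have [n Fn] : exists n, (mu (F n) <= e%:E)%E.
  have : (mu (\bigcap_n F n) < e%:E)%E.
    by apply: le_lt_trans leFI _; rewrite lte_fin ltr_pdivrMr// ltr_pMr// ltr1n.
  rewrite ltNge => /negP; apply: contra_notP => /forallNP h.
  apply: (cvge_ge _ cvgF); apply: nearW => n /=.
  by have /negP := h n; rewrite -ltNge => /ltW.
exists W, (\bigcap_(i < n) V i); split => //.
- by move=> x [k _ Ax]; exists k => //; have [_ _ + _ _] := UV k; exact.
- move=> x nAx i _; have [_ _ _ + _] := UV i; apply => Ax; apply: nAx; by exists i.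
- by rewrite setIAC.
Qed.

Let reg_sigma : sigma_algebra setT reg.
Proof.
split; last exact: reg_bigcup.
- by apply: reg_clopen => [x []|x _]; exists 0%N; rewrite ?setC0.
- by move=> A; rewrite setTD; exact: regC.
Qed.

(** A half space with a dyadic bound is a union of cubes of one level, and so is
    its complement; no approximation is involved. *)
Let reg_dyadic_ray i k (j : int) : reg [set x | j%:~R <= 2 ^+ k * x 0 i].
Proof.
have E x y : dcube k (didx k x) y ->
    (j%:~R <= 2 ^+ k * x 0 i) = (j%:~R <= 2 ^+ k * y 0 i).
  by move=> /rowP/(_ i); rewrite !mxE -!floor_ge_int => ->.
by apply: reg_clopen => x /= h; exists k => y /E /= <-.
Qed.

Let reg_ray i (a : R) : reg [set x | a < x 0 i].
Proof.
suff E : \bigcup_k [set x : 'rV[R]_d | (Num.floor (2 ^+ k * a) + 1)%:~R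
    <= 2 ^+ k * x 0 i] = [set x : 'rV[R]_d | a < x 0 i].
  by apply: eq_ind E; apply: reg_bigcup => k; exact: reg_dyadic_ray.
apply/seteqP; split=> [x [k _] /=|x /= ax]; last first.
  (* a level at which a full unit fits between the rescaled [a] and [x 0 i] *)
  have [k hk] := @exp2_gt (x 0 i - a) ltac:(by rewrite subr_gt0).
  have k0 : 0 < (2 ^+ k : R) by rewrite exprn_gt0.
  exists k => //=; rewrite intrD.
  apply: (@le_trans _ _ (2 ^+ k * a + 1)); first by rewrite lerD2r floor_le.
  move: hk; rewrite -(ltr_pM2l k0) divff ?gt_eqF// mulrBr; move: (_ * a) (_ * x _ _).
  by move=> ? ?; lra.
have k0 : 0 < (2 ^+ k : R) by rewrite exprn_gt0.
move=> h; rewrite -(ltr_pM2l k0); apply: lt_le_trans h; exact: floorD1_gt.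
Qed.

Lemma dopen_regular A : measurable A -> reg A.
Proof.
apply: smallest_sub; first exact: reg_sigma.
rewrite -bigcup_seq => B [i _ [Y mY <-]]; rewrite setTI.
have sY : sigma_algebra [set: R] [set Y | reg ((fun x : 'rV[R]_d => x 0 i) @^-1` Y)].
  split => /=.
  - by rewrite preimage_set0; have [] := reg_sigma.
  - by move=> Z /= rZ; rewrite setTD preimage_setC; exact: regC.
  - by move=> Z rZ; rewrite /= preimage_bigcup; exact: reg_bigcup.
suff : (@ocitv R).-sigma.-measurable `<=`
  [set Y | reg ((fun x : 'rV[R]_d => x 0 i) @^-1` Y)] by apply.
rewrite RGenOInfty.measurableE; apply: smallest_sub => //.
move=> _ [a ->] /=.
have E : [set x : 'rV[R]_d | a < x 0 i] =
    (fun x : 'rV[R]_d => x 0 i) @^-1` `]a, +oo[%classic.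
  by apply/seteqP; split=> x /=; rewrite in_itv/= andbT.
by apply: eq_ind E; exact: reg_ray.
Qed.

End regularity.
End dyadic.

(** * Differentiable maps preserve negligible sets *)

Lemma negligible_small_cover dd (T : measurableType dd) (R : realType)
    (mu : {measure set T -> \bar R}) (A : set T) :
  (forall e : R, 0 < e ->
     exists B, [/\ measurable B, A `<=` B & (mu B <= e%:E)%E]) ->
  mu.-negligible A.
Proof.
move=> h; have /choice[B hB] n : exists B,
    [/\ measurable B, A `<=` B & (mu B <= (n.+1%:R^-1)%:E)%E].
  by apply: h; rewrite invr_gt0 ltr0n.
exists (\bigcap_n B n); split.
- by apply: bigcapT_measurable => n; have [] := hB n.
- apply/eqP; rewrite eq_le measure_ge0 andbT; apply/lee_addgt0Pr => e e0.
  rewrite add0e.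
  have [n ne] : exists n, n.+1%:R^-1 < e.
    exists (Num.trunc e^-1).
    by rewrite -[e in _ < e]invrK ltf_pV2 ?posrE ?invr_gt0// truncnS_gt.
  apply: (@le_trans _ _ (n.+1%:R^-1)%:E); last by rewrite lee_fin ltW.
  have [mB _ Bn] := hB n; apply: le_trans Bn.
  apply: le_measure; rewrite ?inE//; last exact: bigcap_inf.
  by apply: bigcapT_measurable => k; have [] := hB k.
- by move=> x Ax n _; have [_ + _] := hB n; exact.
Qed.

Section cube_volume.
Context {R : realType} {d : nat}.
Local Notation mu := (@lebesgue_rV R d).

Lemma measurable_box (a b : 'rV[R]_d) :
  measurable [set x : 'rV[R]_d | forall i, a 0 i <= x 0 i <= b 0 i].
Proof.
have -> : [set x : 'rV[R]_d | forall i, a 0 i <= x 0 i <= b 0 i] =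
    \bigcap_(i in [set: 'I_d]) ((fun x : 'rV[R]_d => x 0 i) @^-1`
       `[a 0 i, b 0 i]).
  apply/seteqP; split=> [x /= h i _|x h i] /=; first by rewrite in_itv; exact: h.
  by have := h i I; rewrite /= in_itv.
apply: fin_bigcap_measurable => // i _.
by rewrite -[X in measurable X]setTI; apply: measurable_coord.
Qed.

(** Up to a factor [2 ^ d], a cube has the volume that is expected of it.  Only
    closed boxes have a volume known in advance, whence the closed box of half
    the size that shares the lower corner of the half-open cube. *)
Lemma le_lebesgue_dcube k (m : 'rV[int]_d) :
  (((2 ^- k.+1) ^+ d)%:E <= mu (dcube k m))%E.
Proof.
have k0 : 0 < (2 ^+ k : R) by rewrite exprn_gt0.
pose a : 'rV[R]_d := \row_i ((m 0 i)%:~R / 2 ^+ k).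
pose b : 'rV[R]_d := \row_i (((m 0 i)%:~R + 2^-1) / 2 ^+ k).
have <- : mu [set x : 'rV[R]_d | forall i, a 0 i <= x 0 i <= b 0 i] =
    ((2 ^- k.+1) ^+ d)%:E.
  rewrite lebesgue_rV_box => [|i]; last first.
    by rewrite !mxE ler_pM2r ?invr_gt0// lerDl invr_ge0.
  congr EFin; rewrite -[in RHS](card_ord d) -prodr_const; apply: eq_bigr => i _.
  by rewrite !mxE -mulrBl addrAC subrr add0r exprS invfM.
apply: le_measure; rewrite ?inE; [exact: measurable_box|exact: measurable_dcube|].
move=> x /= h; apply/dcubeP => i; have := h i; rewrite !mxE intrD.
rewrite ler_pdivrMr// ler_pdivlMr// mulrC => /andP[-> h2] /=.
by apply: (le_lt_trans h2); rewrite ltrD2l invf_lt1// ltr1n.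
Qed.

Lemma lebesgue_dcube_lty k (m : 'rV[int]_d) : (mu (dcube k m) < +oo)%E.
Proof.
have k0 : 0 < (2 ^+ k : R) by rewrite exprn_gt0.
pose a : 'rV[R]_d := \row_i ((m 0 i)%:~R / 2 ^+ k).
pose b : 'rV[R]_d := \row_i (((m 0 i)%:~R + 1) / 2 ^+ k).
apply: (@le_lt_trans _ _ (mu [set x | forall i, a 0 i <= x 0 i <= b 0 i])).
  apply: le_measure; rewrite ?inE; [exact: measurable_dcube|exact: measurable_box|].
  move=> x /dcubeP h /= i; rewrite !mxE ler_pdivrMr// ler_pdivlMr// mulrC.
  by have /andP[-> h2] := h i; rewrite intrD in h2; exact: ltW.
by rewrite lebesgue_rV_box ?ltry// => i; rewrite !mxE ler_pM2r ?invr_gt0// lerDl.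
Qed.

Lemma negligible_dopen_cover (N D : set 'rV[R]_d) (e : R) :
  mu.-negligible N -> dopen D -> (mu D < +oo)%E -> 0 < e ->
  exists U, [/\ dopen U, N `&` D `<=` U & (mu U <= e%:E)%E].
Proof.
move=> [M [mM M0 NM]] oD Dy e0; have mD := dopen_measurable oD.
have [U [V [oU oV MU MV h]]] := dopen_regular mD Dy mM e0.
have mUV : measurable (U `&` V `&` D).
  by apply: measurableI => //; apply: dopen_measurable; exact: dopenI.
exists (U `&` D); split; first exact: dopenI.
  by move=> x [/NM/MU Ux Dx].
apply: (@le_trans _ _ (mu (M `|` (U `&` V `&` D)))).
  apply: le_measure; rewrite ?inE.
  - by apply: measurableI => //; exact: dopen_measurable.
  - exact: measurableU.
  - move=> x [Ux Dx]; have [Mx|/MV Vx] := pselect (M x); first by left.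
    by right.
by rewrite (le_trans (measureU2 _ _ _))// [X in (X + _)%E]M0 add0e.
Qed.

Variable f : 'rV[R]_d -> 'rV[R]_d.

(** Cover the null set by disjoint small cubes of small total volume.  The image
    of the part of [N] in a cube of side [2 ^- l] lies in a box of half-side
    [K * 2 ^- l], whose volume is at most a constant times that of the cube.
    The images need not be measurable, the boxes are. *)
Lemma lipschitz_negligible (N : set 'rV[R]_d) (K : R) k0 (m0 : 'rV[int]_d) :
  0 <= K -> mu.-negligible N ->
  (forall x y, N x -> N y -> `|y - x| <= 2 ^- k0 -> `|f y - f x| <= K * `|y - x|) ->
  mu.-negligible (f @` (N `&` dcube 0 m0)).
Proof.
move=> K0 N0 fK; apply: negligible_small_cover => e e0.
(* the boxes have side [2 * K * 2 ^- l], to be compared with the side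
   [2 ^- l.+1] of the boxes known to fit in the cubes *)
pose c : R := (4 * K) ^+ d.
have c0 : 0 <= c by rewrite exprn_ge0// mulr_ge0.
have e'0 : 0 < e / (c + 1) by rewrite divr_gt0// ltr_wpDl.
have [U [oU NU Ue]] := negligible_dopen_cover N0 (@dcube_dopen _ _ 0 m0)
  (lebesgue_dcube_lty 0 m0) e'0.
have [J [Jk0 tJ UE]] := dopen_trivIset k0 oU.
pose Q n := oapp (fun km => dcube km.1 km.2) set0 (J n) : set 'rV[R]_d.
rewrite -/Q in tJ UE.
have mQ n : measurable (Q n).
  by rewrite /Q; case: (J n) => //= km; exact: measurable_dcube.
have /choice[B hB] n : exists B : set 'rV[R]_d, [/\ measurable B,
    f @` (N `&` dcube 0 m0 `&` Q n) `<=` B & (mu B <= c%:E * mu (Q n))%E].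
  have [[x [[Nx Dx] Qx]]|noN] := pselect (N `&` dcube 0 m0 `&` Q n !=set0); last first.
    exists set0; split; rewrite ?measure0 ?mule_ge0//; move=> z [x h _].
    by exfalso; apply: noN; exists x.
  move: Qx; rewrite /Q; case Jn : (J n) => [[l m]|//] /= lm.
  have kl := Jk0 _ _ Jn; rewrite /= in kl.
  pose r := K * 2 ^- l.
  have r0 : 0 <= r by rewrite mulr_ge0// invr_ge0 exprn_ge0.
  pose a : 'rV[R]_d := \row_i (f x 0 i - r).
  pose b : 'rV[R]_d := \row_i (f x 0 i + r).
  exists [set z | forall i, a 0 i <= z 0 i <= b 0 i]; split.
  - exact: measurable_box.
  - move=> _ [y [[Ny _] yl] <-] i; rewrite !mxE -ler_distl.
    have yx : `|y - x| <= 2 ^- l by apply: didx_dist; rewrite lm.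
    have : `|f y - f x| <= r.
      apply: le_trans (ler_wpM2l K0 yx); apply: fK => //; apply: (le_trans yx).
      by rewrite lef_pV2 ?posrE ?exprn_gt0// ler_weXn2l// ler1n.
    apply: le_trans; rewrite [`|f y - f x|]mx_normrE.
    have := @le_bigmax _ _ _ 0 (fun ij : 'I_1 * 'I_d => `|(f y - f x) ij.1 ij.2|) (0, i).
    by rewrite !mxE.
  - rewrite lebesgue_rV_box => [|i]; last by rewrite !mxE lerD2l ge0_cp.
    apply: le_trans (lee_wpmul2l _ (le_lebesgue_dcube l m)); last by rewrite lee_fin.
    rewrite -EFinM lee_fin /c -exprMn -[d in X in _ <= X](card_ord d) -prodr_const.
    rewrite le_eqVlt; apply/orP; left; apply/eqP; apply: eq_bigr => i _.
    by rewrite !mxE /r exprS invfM; field; rewrite expf_neq0.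
exists (\bigcup_n B n); split.
- by apply: bigcupT_measurable => n; have [] := hB n.
- move=> _ [x NDx <-]; have : U x by exact: NU.
  rewrite UE => -[n _ Qx]; exists n => //; have [_ + _] := hB n.
  by apply; exists x.
- apply: (@le_trans _ _ (\sum_(0 <= n <oo) mu (B n))%E).
    apply: measure_sigma_subadditive => //.
    + by move=> n; have [] := hB n.
    + by apply: bigcupT_measurable => n; have [] := hB n.
  apply: (@le_trans _ _ (\sum_(0 <= n <oo) (c%:E * mu (Q n)))%E).
    by apply: lee_nneseries => // n _; have [] := hB n.
  rewrite nneseriesZl//.
  rewrite -(measure_semi_bigcup _ mQ tJ); last by rewrite -UE; exact: dopen_measurable.
  rewrite -UE; apply: le_trans (lee_wpmul2l _ Ue) _; first by rewrite lee_fin.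
  rewrite -EFinM lee_fin mulrCA ler_piMr//; first exact: ltW.
  by rewrite ler_pdivrMr ?ltr_wpDl// mul1r lerDl.
Qed.

(** A single integer serves as Lipschitz constant and as radius, which makes the
    family of the sets of points with a given bound countable. *)
Lemma differentiable_pt_lipschitz x : differentiable f x ->
  exists n, forall y, `|y - x| <= 2 ^- n -> `|f y - f x| <= n%:R * `|y - x|.
Proof.
move=> df; have /linear_lipschitz[k k0 hk] := diff_continuous df.
have /(_ _ ltr01) : forall e : R, 0 < e ->
    \forall h \near 0, `|f (h + x) - f x - 'd f x h| <= e * `|h|.
  move=> e e0; near=> h; rewrite (diff_locallyx df) /=.
  rewrite -[_ - f x - _]addrA -opprD [X in X - _]addrC addrK.
  near: h; exact: littleoP.
move=> /nbhs_ballP[e /= e0 he].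
have [l le] := exp2_gt e0.
exists (maxn l (Num.trunc (k + 1)).+1) => y yx.
have lt : `|y - x| < e.
  apply: (le_lt_trans yx); apply: le_lt_trans le.
  by rewrite lef_pV2 ?posrE ?exprn_gt0// ler_weXn2l ?ler1n// leq_maxl.
have := he (y - x); rewrite -ball_normE /= sub0r normrN => /(_ lt).
rewrite subrK mul1r => h.
rewrite -(subrK ('d f x (y - x)) (f y - f x)).
apply: (le_trans (ler_normD _ _)); apply: (le_trans (lerD h (hk _))).
rewrite -[X in X + _]mul1r -mulrDl ler_wpM2r// addrC.
apply: (@le_trans _ _ (Num.trunc (k + 1)).+1%:R).
  exact/ltW/truncnS_gt.
by rewrite ler_nat leq_maxr.
Unshelve. all: by end_near. Qed.

(** Lusin's condition (N).  The null set is the countable union of the pieces on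
    which the map satisfies a uniform Lipschitz bound at small distances. *)
Lemma differentiable_negligible (N : set 'rV[R]_d) :
  (forall x, differentiable f x) -> mu.-negligible N -> mu.-negligible (f @` N).
Proof.
move=> df N0.
pose Nn n := [set x | N x /\
  forall y, `|y - x| <= 2 ^- n -> `|f y - f x| <= n%:R * `|y - x|].
pose F j := oapp (fun nm : nat * 'rV[int]_d => f @` (Nn nm.1 `&` dcube 0 nm.2))
  set0 (unpickle j).
apply: (@negligibleS _ _ _ _ (\bigcup_j F j)); last first.
  apply: negligible_bigcup => j; rewrite /F; case: unpickle => [[n m]|] /=.
    apply: (@lipschitz_negligible _ n%:R n) => //.
    - by apply: negligibleS N0 => x [].
    - by move=> x y [_ hx] _ ; exact: hx.
  exact: negligible_set0.
move=> _ [x Nx <-]; have [n hn] := differentiable_pt_lipschitz (df x).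
exists (pickle (n, didx 0 x)) => //; rewrite /F pickleK/=.
by exists x => //; split.
Qed.

End cube_volume.

(** * Measurability and invertibility of Jacobian matrices *)

Lemma harmonic_dnbhs (R : realType) : @harmonic R n @[n --> \oo] --> 0^'.
Proof.
move=> A A0; have A1 : nbhs (0 : R) [set y | y != 0 -> A y] by [].
have : \forall n \near \oo, [set y | y != 0 -> A y] (@harmonic R n).
  exact: cvg_harmonic A1.
by apply: filterS => n; apply; rewrite gt_eqF// harmonic_gt0.
Qed.

Section measurability.
Context {R : realType} {d : nat}.

Lemma rV_addl_continuous (v : 'rV[R]_d) : continuous (fun x : 'rV[R]_d => v + x).
Proof.
move=> x; apply: (@cvgD R 'rV[R]_d _ (nbhs x) _ (cst v) id).
  exact: cvg_cst.
exact: cvg_id.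
Qed.

Lemma rV_subr_continuous (v : 'rV[R]_d) : continuous (fun x : 'rV[R]_d => x - v).
Proof.
move=> x; apply: (@cvgB R 'rV[R]_d _ (nbhs x) _ id (cst v)).
  exact: cvg_id.
exact: cvg_cst.
Qed.

Lemma rV_subl_continuous (v : 'rV[R]_d) : continuous (fun x : 'rV[R]_d => v - x).
Proof.
move=> x; apply: (@cvgB R 'rV[R]_d _ (nbhs x) _ (cst v) id).
  exact: cvg_cst.
exact: cvg_id.
Qed.

Lemma continuous_coord_comp n (f : 'rV[R]_d -> 'rV[R]_n) j :
  continuous f -> continuous (fun x => f x 0 j).
Proof.
move=> cf x; apply: (@continuous_comp _ _ _ f (fun v : 'rV[R]_n => v 0 j)).
  exact: cf.
exact: coord_continuous.
Qed.

Lemma continuous_measurable_rV n (f : 'rV[R]_d -> 'rV[R]_n) :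
  continuous f -> measurable_fun setT f.
Proof.
move=> cf; apply/measurable_fun_rVP => i.
by apply: continuous_measurable_fun_rV; exact: continuous_coord_comp.
Qed.

(** The partial derivatives are limits of the difference quotients of step
    [1 / k.+1], which are continuous. *)
Lemma measurable_jacobian n (f : 'rV[R]_d -> 'rV[R]_n) i j :
  (forall x, differentiable f x) -> measurable_fun setT (fun x => 'J f x i j).
Proof.
move=> df.
have cf : continuous f by move=> x; exact: differentiable_continuous.
pose v : 'rV[R]_d := delta_mx 0 i.
pose h k x := (harmonic k)^-1 * (f (harmonic k *: v + x) 0 j - f x 0 j).
apply: (@measurable_fun_cvg _ _ _ _ h) => [k|x _].
  apply: measurable_funM => //; apply: measurable_funB.
    apply: continuous_measurable_fun_rV; apply: continuous_coord_comp => x.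
    apply: (@continuous_comp _ _ _ (fun x => harmonic k *: v + x) f); last exact: cf.
    exact: rV_addl_continuous.
  by apply: continuous_measurable_fun_rV; exact: continuous_coord_comp.
have -> : 'J f x i j = ('D_v f x) 0 j by rewrite deriveE// mxE.
have /(cvg_comp _ _ (@harmonic_dnbhs R)) := @diff_derivable _ _ _ f x v (df x).
move=> /(cvg_comp _ _)/(_ (@coord_continuous _ _ _ 0 j _)).
apply: cvg_trans; apply: near_eq_cvg; apply: nearW => k /=.
by rewrite /h !mxE.
Qed.

Lemma measurable_det_jacobian (f : 'rV[R]_d -> 'rV[R]_d) :
  (forall x, differentiable f x) -> measurable_fun setT (fun x => \det ('J f x)).
Proof.
move=> df; apply: measurable_sum => s; apply: measurable_funM => //.
by apply: measurable_prod => i _; exact: measurable_jacobian.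
Qed.

End measurability.

Lemma det_jacobian_neq0 (R : realType) d (T Tinv : 'rV[R]_d -> 'rV[R]_d) x :
  cancel Tinv T -> differentiable Tinv x -> differentiable T (Tinv x) ->
  \det ('J Tinv x) != 0.
Proof.
move=> TinvK dTinv dT.
have JJ : 'J Tinv x *m 'J T (Tinv x) = 1%:M.
  apply/row_matrixP => i; rewrite !rowE mulmx1 mulmxA !mul_rV_lin1/=.
  rewrite -[LHS]/(('d T (Tinv x) \o 'd Tinv x) (delta_mx 0 i)) -diff_comp//.
  rewrite (_ : T \o Tinv = id); last exact/funext.
  by rewrite (@diff_val _ _ _ _ _ _ _ (is_diff_id x)).
move: JJ; move: ('J Tinv x) ('J T (Tinv x)) => A B AB.
apply/eqP => det0; have := det_mulmx A B.
by rewrite det0 mul0r AB det1 => /eqP; rewrite oner_eq0.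
Qed.

(** * Integrals of products over the coordinates *)

Section product_integral.
Context {R : realType}.

Lemma measurable_prod_coord d (g : R -> R) : measurable_fun setT g ->
  measurable_fun setT (fun x : 'rV[R]_d => \prod_(i < d) g (x 0 i)).
Proof.
move=> mg; apply: measurable_prod => i _.
by apply: measurableT_comp => //; exact: measurable_coord.
Qed.

(** Tonelli's theorem, one coordinate at a time. *)
Lemma integral_prod_coord (g : R -> R) d : measurable_fun setT g ->
  (forall t, 0 <= g t) -> (\int[lebesgue_measure]_t (g t)%:E = 1)%E ->
  (\int[lebesgue_rV d]_x (\prod_(i < d) g (x 0 i))%:E = 1)%E.
Proof.
move=> mg g0 g1; elim: d => [|d IH].
  under eq_integral do rewrite big_ord0.
  by rewrite integral_cst// mul1e /= diracT.
transitivity (\int[pushforward (lebesgue_measure \x lebesgue_rV d)%E (@rV_cons R d)]_x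
  (\prod_(i < d.+1) g (x 0%R i))%:E)%E; first by [].
rewrite ge0_integral_pushforward//; first last.
- by move=> x _; rewrite lee_fin prodr_ge0.
- by apply/measurable_EFinP; exact: measurable_prod_coord.
- exact: measurable_rV_cons.
rewrite preimage_setT.
transitivity (\int[lebesgue_measure \x lebesgue_rV d]_z
    (g z.1 * \prod_(i < d) g (z.2 0%R i))%:E)%E.
  apply: eq_integral => z _ /=; rewrite big_ord_recl rV_cons0.
  by congr (_ * _)%:E; apply: eq_bigr => i _; rewrite rV_consS.
rewrite fubini_tonelli1; first last.
- by move=> z; rewrite lee_fin mulr_ge0// prodr_ge0.
- apply/measurable_EFinP; apply: measurable_funM.
    by apply: measurableT_comp => //; exact: measurable_fst.
  apply: (@measurableT_comp _ _ _ _ _ _ (fun x : 'rV[R]_d => \prod_(i < d) g (x 0 i))).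
    exact: measurable_prod_coord.
  exact: measurable_snd.
rewrite -[RHS]g1; apply: eq_integral => t _; rewrite /fubini_F /=.
under eq_integral do rewrite EFinM.
rewrite ge0_integralZl//.
- by rewrite IH mule1.
- by apply/measurable_EFinP; exact: measurable_prod_coord.
- by move=> x _; rewrite lee_fin prodr_ge0.
- by rewrite lee_fin.
Qed.

End product_integral.

(** * Distance to a compact set *)

Section projection.
Context {R : realType} {d : nat}.
Implicit Types (C : set 'rV[R]_d) (x v : 'rV[R]_d).

Lemma euclid_norm_continuous : continuous (@euclid_norm R d).
Proof.
move=> x; apply: (@continuous_comp _ _ _ _ Num.sqrt); last exact: sqrt_continuous.
apply: (@cvg_big _ _ _ _ _ (@add_continuous _) _ (nbhs x) _
  (fun i (x : 'rV[R]_d) => x 0 i ^+ 2) (fun i => x 0 i ^+ 2)) => i _.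
rewrite expr2.
under eq_fun do rewrite expr2.
by apply: cvgM; exact: coord_continuous.
Qed.

Lemma euclid_proj_spec C x : C !=set0 -> compact C ->
  C (euclid_proj C x) /\
  forall v, C v -> euclid_norm (x - euclid_proj C x) <= euclid_norm (x - v).
Proof.
move=> C0 cC.
have ct : continuous (fun v : 'rV[R]_d => euclid_norm (x - v)).
  move=> v; apply: (@continuous_comp _ _ _ (fun v => x - v)).
    exact: rV_subl_continuous.
  exact: euclid_norm_continuous.
have [u uC hu] := EVT_min_rV C0 cC (continuous_subspaceT ct).
apply: (@getPex _ [set u | C u /\ forall v, C v ->
  euclid_norm (x - u) <= euclid_norm (x - v)]).
exists u; split; first by rewrite inE in uC.
by move=> v Cv; apply: hu; rewrite inE.
Qed.

Lemma sqr_euclid_norm x : euclid_norm x ^+ 2 = \sum_(i < d) x 0 i ^+ 2.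
Proof. by rewrite sqr_sqrtr// sumr_ge0// => i _; exact: sqr_ge0. Qed.

(** The distance to [C] is below [a] exactly when some point of [C] is at distance
    less than [a], so its strict sublevel sets are open as unions of open
    balls.  This bypasses the continuity of the projection. *)
Lemma measurable_dist C : C !=set0 -> compact C ->
  measurable_fun setT (fun x => euclid_norm (x - euclid_proj C x)).
Proof.
move=> C0 cC; apply: (measurability _ (RGenInftyO.measurableE R)) => _ [_ [a ->] <-].
rewrite setTI.
have -> : (fun x => euclid_norm (x - euclid_proj C x)) @^-1` `]-oo, a[ =
    \bigcup_(v in C) ((fun x => euclid_norm (x - v)) @^-1` `]-oo, a[).
  apply/seteqP; split=> x /=; rewrite in_itv/=.
    by exists (euclid_proj C x); [exact: (euclid_proj_spec x C0 cC).1|rewrite /= in_itv].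
  move=> [v Cv] /=; rewrite in_itv/=; apply: le_lt_trans.
  exact: (euclid_proj_spec x C0 cC).2.
apply: dopen_measurable; apply: open_dopen; apply: bigcup_open => v _.
suff /continuousP : continuous (fun x : 'rV[R]_d => euclid_norm (x - v)).
  by apply; exact: interval_open.
move=> x; apply: (@continuous_comp _ _ _ (fun x => x - v)).
  exact: rV_subr_continuous.
exact: euclid_norm_continuous.
Qed.

Lemma moreau_indicatorE C lambda x : moreau_indicator C lambda x =
  euclid_norm (x - euclid_proj C x) ^+ 2 / (2 * lambda).
Proof. by rewrite /moreau_indicator mulrC. Qed.

(** As [C] is bounded, say by [M + 1] in every coordinate, [(a - b) ^+ 2] is at
    least [a ^+ 2 / 2 - (M + 1) ^+ 2] for a coordinate [b] of the projection.
    The variance [2 * lambda] is the one for which the exponent of the normal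
    density is [- a ^+ 2 / (4 * lambda)]. *)
Lemma expR_moreau_le C lambda : C !=set0 -> compact C -> 0 < lambda ->
  exists2 c : R, 0 <= c & forall x, expR (- moreau_indicator C lambda x) <=
    c * \prod_(i < d) normal_pdf 0 (Num.sqrt (2 * lambda)) (x 0 i).
Proof.
move=> C0 cC l0; set s := Num.sqrt _.
have s0 : 0 < s by rewrite sqrtr_gt0 mulr_gt0.
have s2 : s ^+ 2 = 2 * lambda by rewrite sqr_sqrtr// mulr_ge0// ltW.
have [M [_ hM]] := compact_bounded cC.
have {hM} hM u i : C u -> `|u 0 i| <= M + 1.
  move=> Cu; apply: le_trans (hM (M + 1) _ u Cu); last by rewrite ltrDl.
  rewrite [`|u|]mx_normrE.
  exact: (@le_bigmax _ _ _ 0 (fun ij : 'I_1 * 'I_d => `|u ij.1 ij.2|) (0, i)).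
have p0 : 0 < normal_peak s by rewrite normal_peak_gt0// gt_eqF.
exists (\prod_(i < d) (expR ((M + 1) ^+ 2 / s ^+ 2) / normal_peak s)).
  by apply: prodr_ge0 => i _; rewrite divr_ge0 ?expR_ge0// ltW.
move=> x; have [Cu _] := euclid_proj_spec x C0 cC.
rewrite moreau_indicatorE sqr_euclid_norm mulr_suml -sumrN expR_sum -big_split /=.
apply: ler_prod => i _; rewrite expR_ge0 /=.
rewrite normal_pdfE ?gt_eqF// /normal_fun subr0.
rewrite mulrA divfK ?gt_eqF// -expRD ler_expR -s2 !mxE.
set u := euclid_proj C x.
have := hM u i Cu; move: (x 0 i) (u 0 i) => a b hb.
have hb2 : b ^+ 2 <= (M + 1) ^+ 2.
  by rewrite -[b ^+ 2]real_normK ?num_real// lerXn2r ?nnegrE// (le_trans _ hb).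
have -> : - a ^+ 2 / (s ^+ 2 *+ 2) = (- a ^+ 2 / 2) / s ^+ 2.
  by rewrite -mulr_natr invfM mulrA mulrAC.
rewrite -mulNr -mulrDl.
rewrite ler_pM2r ?invr_gt0 ?exprn_gt0//.
have := sqr_ge0 (a - 2 * b); move: hb2; move: ((M + 1) ^+ 2) => c hc.
by nra.
Qed.

End projection.

(** * The density of a normalizing flow *)

Lemma bounded_above_of_ereal_sup (T : Type) (R : realType) (f : T -> R) :
  (ereal_sup [set (f x)%:E | x in setT] < +oo)%E ->
  exists2 M : R, 0 <= M & forall x, f x <= M.
Proof.
(* [T] may be empty, in which case the supremum is [-oo] *)
set s := ereal_sup _ => s_lty; exists (Num.max 0 (fine s)) => [|x].
  by rewrite le_max lexx.
rewrite le_max; apply/orP; right.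
have fs : ((f x)%:E <= s)%E by apply: ereal_sup_ubound; exists x.
by move: s s_lty fs => [r| |].
Qed.

Section flow.
Variables (R : realType) (d : nat) (qz : 'rV[R]_d -> R).
Variables (T Tinv : 'rV[R]_d -> 'rV[R]_d).
Hypotheses (TK : cancel T Tinv) (TinvK : cancel Tinv T).
Hypotheses (T_diff : forall z, differentiable T z).
Hypotheses (Tinv_diff : forall x, differentiable Tinv x).
Hypothesis (qz_density : is_density qz).
Local Notation q := (flow_density qz Tinv).

Lemma flow_density_ge0 x : 0 <= q x.
Proof. by have [_ qz0 _] := qz_density; rewrite mulr_ge0. Qed.

Lemma measurable_flow_density : measurable_fun setT q.
Proof.
have [mqz _ _] := qz_density.
apply: measurable_funM.
  apply: measurableT_comp => //; apply: continuous_measurable_rV => x.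
  exact: differentiable_continuous.
by apply: measurableT_comp => //; exact: measurable_det_jacobian.
Qed.

(** Replaces the change of variables formula.  The Jacobian determinant never
    vanishes, so [Tinv] maps the support of the flow density onto that of [qz];
    if the former were negligible, so would be the latter, and the integral of
    [qz] would be 0. *)
Lemma flow_density_support_not_negligible :
  ~ (lebesgue_rV d).-negligible [set x | q x != 0].
Proof.
move=> /(differentiable_negligible Tinv_diff) N.
have [mqz qz0 qz1] := qz_density.
have : (\int[lebesgue_rV d]_z (qz z)%:E = 0)%E.
  rewrite (ge0_ae_eq_integral (g := cst 0%E)) ?integral0//.
  - exact/measurable_EFinP.
  - by move=> z _; rewrite lee_fin.
  - apply: negligibleS N => z /= h.
    exists (T z); last exact: TK.
    rewrite /= /flow_density TK mulf_neq0//; last first.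
      rewrite normr_eq0; apply: (det_jacobian_neq0 TinvK) => //.
    by apply/eqP => qz_eq0; apply: h => _; rewrite qz_eq0.
by rewrite qz1 => /eqP; rewrite onee_eq0.
Qed.

End flow.

(** * The posterior density *)

Section posterior.
Variables (R : realType) (m d : nat) (p : 'rV[R]_m -> 'rV[R]_d -> R).
Variables (q : 'rV[R]_d -> R) (C : set 'rV[R]_d) (lambda alpha : R) (y : 'rV[R]_m).
Hypotheses (mp : measurable_fun setT (p y)) (mq : measurable_fun setT q).
Hypotheses (p_gt0 : forall x, 0 < p y x) (q_ge0 : forall x, 0 <= q x).
Hypotheses (C0 : C !=set0) (cC : compact C).
Local Notation g := (posterior_unnormalized p q C lambda alpha y).
Local Notation Z := (posterior_normalization p q C lambda alpha y).

Lemma posterior_unnormalized_ge0 x : 0 <= g x.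
Proof. by rewrite !mulr_ge0 ?powR_ge0 ?expR_ge0// ltW. Qed.

Lemma measurable_posterior_unnormalized : measurable_fun setT g.
Proof.
apply: measurable_funM.
  apply: measurable_funM => //.
  by apply: (measurableT_comp (measurable_powR alpha)).
apply: measurableT_comp => //; apply: measurableT_comp => //.
apply: measurable_funM => //.
by apply: measurable_funX; exact: measurable_dist.
Qed.

Lemma posterior_normalization_lty M B : 0 < lambda -> 0 <= alpha ->
  0 <= M -> (forall x, p y x <= M) -> (forall x, q x <= B) -> (Z < +oo)%E.
Proof.
move=> l0 a0 M0 pM qB; have [c c0 hc] := expR_moreau_le C0 cC l0.
set s := Num.sqrt _ in hc.
have B0 : 0 <= B by apply: le_trans (q_ge0 0) (qB 0).
pose G (x : 'rV[R]_d) : R := \prod_(i < d) normal_pdf 0 s (x 0 i).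
pose k : R := M * B `^ alpha * c.
have k0 : 0 <= k by rewrite !mulr_ge0 ?powR_ge0.
have mG : measurable_fun setT G by apply: measurable_prod_coord; exact: measurable_normal_pdf.
have G0 x : 0 <= G x by rewrite prodr_ge0// => i _; exact: normal_pdf_ge0.
apply: (@le_lt_trans _ _ (\int[lebesgue_rV d]_x (k%:E * (G x)%:E))%E).
  apply: ge0_le_integral => //.
  - by move=> x _; rewrite lee_fin posterior_unnormalized_ge0.
  - by apply/measurable_EFinP; exact: measurable_posterior_unnormalized.
  - by apply/measurable_EFinP; apply: measurable_funM.
  - move=> x _; rewrite -EFinM lee_fin /k -[X in _ <= X]mulrA.
    apply: ler_pM => //; first by rewrite mulr_ge0 ?powR_ge0// ltW.
    apply: ler_pM => //; [exact: ltW|exact: powR_ge0|].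
    by apply: ge0_ler_powR; rewrite ?nnegrE.
rewrite ge0_integralZl//.
- rewrite integral_prod_coord ?mule1 ?ltry//.
  + exact: measurable_normal_pdf.
  + by move=> t; exact: normal_pdf_ge0.
  + exact: integral_normal_pdf.
- exact/measurable_EFinP.
- by move=> x _; rewrite lee_fin.
Qed.

Lemma posterior_normalization_gt0 :
  ~ (lebesgue_rV d).-negligible [set x | q x != 0] -> (0 < Z)%E.
Proof.
move=> nq; rewrite lt_neqAle; apply/andP; split; last first.
  by apply: integral_ge0 => x _; rewrite lee_fin posterior_unnormalized_ge0.
apply/eqP => Z0; apply: nq.
have : ae_eq (lebesgue_rV d) setT (EFin \o g) (cst 0%E).
  apply/ae_eq_integral_abs => //.
    by apply/measurable_EFinP; exact: measurable_posterior_unnormalized.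
  rewrite Z0; apply: eq_integral => x _ /=.
  by rewrite ger0_norm// posterior_unnormalized_ge0.
apply: negligibleS => x /= qx0 /(_ I) [] /eqP; apply/negP.
rewrite !mulf_neq0 ?gt_eqF ?expR_gt0 ?powR_gt0//.
by rewrite lt_neqAle eq_sym qx0 q_ge0.
Qed.

Lemma posterior_is_density : (0 < Z < +oo)%E ->
  is_density (posterior p q C lambda alpha y).
Proof.
move=> /andP[Z0 Zy].
have Zfin : Z \is a fin_num by rewrite ge0_fin_numE// ltW.
have fZ0 : 0 < fine Z by rewrite fine_gt0// Z0.
have mg := measurable_posterior_unnormalized.
split.
- by apply: measurable_funM.
- by move=> x; rewrite divr_ge0 ?posterior_unnormalized_ge0// ltW.
- under eq_integral do rewrite /posterior mulrC EFinM.
  rewrite ge0_integralZl//.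
  + rewrite -/Z -[X in (_ * X)%E](fineK Zfin) -EFinM mulVf// gt_eqF//.
  + exact/measurable_EFinP.
  + by move=> x _; rewrite lee_fin posterior_unnormalized_ge0.
  + by rewrite lee_fin invr_ge0 ltW.
Qed.

End posterior.

Theorem corollary3p4 (R : realType) (m d : nat)
    (qz : 'rV[R]_d -> R) (T Tinv : 'rV[R]_d -> 'rV[R]_d)
    (qtheta : 'rV[R]_d -> R) (p : 'rV[R]_m -> 'rV[R]_d -> R) (lambda : R)
    (qz_density : is_density qz)
    (TK : cancel T Tinv) (TinvK : cancel Tinv T)
    (T_diff : forall z, differentiable T z)
    (Tinv_diff : forall x, differentiable Tinv x)
    (qthetaE : qtheta = flow_density qz Tinv)
    (qtheta_bounded : (ereal_sup [set (qtheta x)%:E | x in setT] < +oo)%E)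
    (p_bounded : forall y, (ereal_sup [set (p y x)%:E | x in setT] < +oo)%E)
    (p_gt0 : forall y x, 0 < p y x)
    (p_C1 : forall y, C1 (p y))
    (lambda_gt0 : 0 < lambda) :
  forall (C : set 'rV[R]_d) (alpha : R) (y : 'rV[R]_m),
    C !=set0 -> convex_set C -> compact C -> 0 < alpha ->
    [/\ (\int[lebesgue_rV d]_x
           (p y x * qtheta x `^ alpha
            * expR (- (euclid_norm (x - euclid_proj C x) ^+ 2 / (2 * lambda))))%:E < +oo)%E,
        (0 < posterior_normalization p qtheta C lambda alpha y < +oo)%E &
        is_density (posterior p qtheta C lambda alpha y)].
Proof.
move=> C alpha y C0 _ cC alpha_gt0.
have mp : measurable_fun setT (p y).
  apply: continuous_measurable_fun_rV => x; apply: differentiable_continuous.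
  exact: (p_C1 y).1.
have mq : measurable_fun setT qtheta.
  by rewrite qthetaE; exact: measurable_flow_density.
have q_ge0 x : 0 <= qtheta x by rewrite qthetaE; exact: flow_density_ge0.
have [M M0 pM] := bounded_above_of_ereal_sup (p_bounded y).
have [B _ qB] := bounded_above_of_ereal_sup qtheta_bounded.
have Zy : (posterior_normalization p qtheta C lambda alpha y < +oo)%E.
  exact: (posterior_normalization_lty mp mq (p_gt0 y) q_ge0 C0 cC lambda_gt0
    (ltW alpha_gt0) M0 pM qB).
have Z0 : (0 < posterior_normalization p qtheta C lambda alpha y)%E.
  apply: posterior_normalization_gt0 => //.
  by rewrite qthetaE; exact: (flow_density_support_not_negligible TK).
split; last by apply: posterior_is_density => //; rewrite Z0.
- by under eq_integral do rewrite -moreau_indicatorE.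
- by rewrite Z0.
Qed.
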